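(* Let $\mathcal{R}$ be a commutative ring with unity, $\mathcal{A}$ a unital $\mathcal{R}$-algebra and $\mathcal{M}$ a unital $\mathcal{A}$-bimodule. The trivial extension algebra $\mathcal{A}\ltimes\mathcal{M}$ has a triangular matrix representation if and only if there exists a nontrivial idempotent $e$ of $\mathcal{A}$ such that $(1-e)\mathcal{A}e=0$ and $(1-e)\mathcal{M}e=0$. In particular, if $\mathcal{A}\ltimes\mathcal{M}$ has a triangular matrix representation, then so has $\mathcal{A}$.
   Context: The trivial extension algebra $\mathcal{A}\ltimes\mathcal{M}$ is $\mathcal{A}\times\mathcal{M}$ with componentwise addition and scalar multiplication and product $(a,m)(b,n)=(ab,an+mb)$; it is a unital $\mathcal{R}$-algebra. For unital $\mathcal{R}$-algebras $A,B$ and a unital $(A,B)$-bimodule $M$, the triangular matrix algebra $\mathrm{Tri}(A;M;B)$ is the $\mathcal{R}$-algebra of matrices $\begin{pmatrix} a & m\\ 0 & b\end{pmatrix}$ ($a\in A$, $m\in M$, $b\in B$) with the usual matrix operations. An algebra has a triangular matrix representation if it is isomorphic, as an $\mathcal{R}$-algebra, to some $\mathrm{Tri}(A;M;B)$ with $A$ and $B$ nonzero. An idempotent $e$ is nontrivial if $e\neq 0,1$. *)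

(* Defs.v *)
From HB Require Import structures.
From mathcomp Require Import all_boot all_order all_algebra.

Set Implicit Arguments.
Unset Strict Implicit.
Unset Printing Implicit Defensive.

Import GRing.Theory.

Local Open Scope ring_scope.

(* Unital associative R-algebras, zero algebra included. The library's algType R
   also requires 1 != 0; a plain record is used because Hierarchy Builder does
   not accept a new join of pzRingType and lmodType R above lalgType R. *)
Record pzAlgebra (R : comPzRingType) := PzAlgebra {
  pzalg_ring : pzRingType;
  pzalg_scale : R -> pzalg_ring -> pzalg_ring;
  pzalg_scaleA : forall (k l : R) (a : pzalg_ring),
    pzalg_scale k (pzalg_scale l a) = pzalg_scale (k * l) a;
  pzalg_scale1 : left_id 1 pzalg_scale;
  pzalg_scaleDr : right_distributive pzalg_scale +%R;
  pzalg_scaleDl : forall a : pzalg_ring,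
    {morph pzalg_scale^~ a : k l / k + l};
  pzalg_scaleAl : forall (k : R) (a b : pzalg_ring),
    pzalg_scale k (a * b) = pzalg_scale k a * b;
  pzalg_scaleAr : forall (k : R) (a b : pzalg_ring),
    pzalg_scale k (a * b) = a * pzalg_scale k b
}.

Definition pzalg_sort (R : comPzRingType) (A : pzAlgebra R) : Type :=
  pzalg_ring A.
Coercion pzalg_sort : pzAlgebra >-> Sortclass.

HB.instance Definition _ (R : comPzRingType) (A : pzAlgebra R) :=
  GRing.PzRing.on (pzalg_sort A).
HB.instance Definition _ (R : comPzRingType) (A : pzAlgebra R) :=
  GRing.Zmodule_isLmodule.Build R (pzalg_sort A)
    (@pzalg_scaleA R A) (@pzalg_scale1 R A)
    (@pzalg_scaleDr R A) (@pzalg_scaleDl R A).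

Section PzAlgebraTheory.
Variables (R : comPzRingType) (A : pzAlgebra R).

Lemma pzscalerAl (k : R) (a b : A) : k *: (a * b) = (k *: a) * b.
Proof. exact: pzalg_scaleAl. Qed.

Lemma pzscalerAr (k : R) (a b : A) : k *: (a * b) = a * (k *: b).
Proof. exact: pzalg_scaleAr. Qed.

End PzAlgebraTheory.

Definition pzAlgebra_of_algType (R : comPzRingType) (A : algType R) :
    pzAlgebra R :=
  @PzAlgebra R A *:%R (@scalerA R A) (@scale1r R A) (@scalerDr R A)
    (@scalerDl R A) (@scalerAl R A) (@scalerAr R A).

(* Unital (A, B)-bimodules. The scalars act centrally: by lactZl and ractZr,
   (k *: 1) m = k *: m = m (k *: 1). *)
HB.mixin Record Lmodule_isBimodule (R : comPzRingType) (A B : pzAlgebra R) M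
    of GRing.Lmodule R M := {
  lact : A -> M -> M;
  ract : M -> B -> M;
  lactA : forall a a' m, lact (a * a') m = lact a (lact a' m);
  lact1 : forall m, lact 1 m = m;
  lactDl : forall a a' m, lact (a + a') m = lact a m + lact a' m;
  lactDr : forall a m m', lact a (m + m') = lact a m + lact a m';
  lactZl : forall k a m, lact (k *: a) m = k *: lact a m;
  ractA : forall m b b', ract m (b * b') = ract (ract m b) b';
  ract1 : forall m, ract m 1 = m;
  ractDl : forall m m' b, ract (m + m') b = ract m b + ract m' b;
  ractDr : forall m b b', ract m (b + b') = ract m b + ract m b';
  ractZr : forall k m b, ract m (k *: b) = k *: ract m b;
  lract : forall a m b, ract (lact a m) b = lact a (ract m b)
}.

#[short(type="bimodType")]
HB.structure Definition Bimodule (R : comPzRingType) (A B : pzAlgebra R) :=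
  {M of GRing.Lmodule R M & Lmodule_isBimodule R A B M}.

Section BimoduleTheory.
Variables (R : comPzRingType) (A B : pzAlgebra R) (M : bimodType A B).

Lemma lactZr k (a : A) (m : M) : lact a (k *: m) = k *: lact a m.
Proof.
by rewrite -[m in LHS]lact1 -lactZl -lactA -pzscalerAr mulr1 lactZl.
Qed.

Lemma ractZl k (m : M) (b : B) : ract (k *: m) b = k *: ract m b.
Proof.
by rewrite -[m in LHS]ract1 -ractZr -ractA -pzscalerAl mul1r ractZr.
Qed.

Lemma lactr0 (a : A) : lact a (0 : M) = 0.
Proof. by apply: (addrI (lact a 0)); rewrite -lactDr !addr0. Qed.

Lemma ractl0 (b : B) : ract (0 : M) b = 0.
Proof. by apply: (addrI (ract 0 b)); rewrite -ractDl !addr0. Qed.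

End BimoduleTheory.

Section TrivialExtension.
Variables (R : comPzRingType) (A : pzAlgebra R) (M : bimodType A A).

Definition trivext_sort : Type := (A * M)%type.

HB.instance Definition _ := GRing.Lmodule.on trivext_sort.

Definition trivext_one : trivext_sort := (1, 0).
Definition trivext_mul (x y : trivext_sort) : trivext_sort :=
  (x.1 * y.1, lact x.1 y.2 + ract x.2 y.1).

Fact trivext_mulA : associative trivext_mul.
Proof.
move=> [a m] [b n] [c p]; congr pair => /=; first exact: mulrA.
by rewrite lactDr ractDl lactA ractA lract addrA.
Qed.

Fact trivext_mul1r : left_id trivext_one trivext_mul.
Proof. by move=> [a m]; congr pair; rewrite /= ?mul1r // lact1 ractl0 addr0. Qed.

Fact trivext_mulr1 : right_id trivext_one trivext_mul.
Proof. by move=> [a m]; congr pair; rewrite /= ?mulr1 // ract1 lactr0 add0r. Qed.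

Fact trivext_mulDl : left_distributive trivext_mul +%R.
Proof.
move=> [a m] [b n] [c p]; congr pair => /=; first exact: mulrDl.
by rewrite lactDl ractDl addrACA.
Qed.

Fact trivext_mulDr : right_distributive trivext_mul +%R.
Proof.
move=> [a m] [b n] [c p]; congr pair => /=; first exact: mulrDr.
by rewrite lactDr ractDr addrACA.
Qed.

HB.instance Definition _ := GRing.Zmodule_isPzRing.Build trivext_sort
  trivext_mulA trivext_mul1r trivext_mulr1 trivext_mulDl trivext_mulDr.

Fact trivext_scaleAl (k : R) (x y : trivext_sort) : k *: (x * y) = (k *: x) * y.
Proof.
case: x y => [a m] [b n]; congr pair => /=; first exact: pzscalerAl.
by rewrite scalerDr lactZl ractZl.
Qed.

Fact trivext_scaleAr (k : R) (x y : trivext_sort) : k *: (x * y) = x * (k *: y).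
Proof.
case: x y => [a m] [b n]; congr pair => /=; first exact: pzscalerAr.
by rewrite scalerDr lactZr ractZr.
Qed.

Definition trivext : pzAlgebra R :=
  @PzAlgebra R trivext_sort *:%R (@scalerA R trivext_sort) (@scale1r R trivext_sort)
    (@scalerDr R trivext_sort) (@scalerDl R trivext_sort)
    trivext_scaleAl trivext_scaleAr.

End TrivialExtension.

Arguments trivext {R} A M.

(* ((a, m), b) stands for the matrix with rows (a, m) and (0, b). *)
Section TriangularAlgebra.
Variables (R : comPzRingType) (A B : pzAlgebra R) (M : bimodType A B).

Definition tri_sort : Type := (A * M * B)%type.

HB.instance Definition _ := GRing.Lmodule.on tri_sort.

Definition tri_one : tri_sort := ((1, 0), 1).
Definition tri_mul (x y : tri_sort) : tri_sort :=
  let: ((a, m), b) := x in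
  let: ((a', m'), b') := y in
  ((a * a', lact a m' + ract m b'), b * b').

Fact tri_mulA : associative tri_mul.
Proof.
move=> [[a m] b] [[a' m'] b'] [[a'' m''] b''].
congr (_, _, _); rewrite ?mulrA //.
by rewrite lactDr ractDl lactA ractA lract addrA.
Qed.

Fact tri_mul1r : left_id tri_one tri_mul.
Proof.
by move=> [[a m] b]; rewrite /= !mul1r lact1 ractl0 addr0.
Qed.

Fact tri_mulr1 : right_id tri_one tri_mul.
Proof.
by move=> [[a m] b]; rewrite /= !mulr1 ract1 lactr0 add0r.
Qed.

Fact tri_mulDl : left_distributive tri_mul +%R.
Proof.
move=> [[a m] b] [[a' m'] b'] [[a'' m''] b''].
by congr (_, _, _); rewrite ?mulrDl // lactDl ractDl addrACA.
Qed.

Fact tri_mulDr : right_distributive tri_mul +%R.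
Proof.
move=> [[a m] b] [[a' m'] b'] [[a'' m''] b''].
by congr (_, _, _); rewrite ?mulrDr // lactDr ractDr addrACA.
Qed.

HB.instance Definition _ := GRing.Zmodule_isPzRing.Build tri_sort
  tri_mulA tri_mul1r tri_mulr1 tri_mulDl tri_mulDr.

Fact tri_scaleAl (k : R) (x y : tri_sort) : k *: (x * y) = (k *: x) * y.
Proof.
case: x y => [[a m] b] [[a' m'] b'].
congr (_, _, _); rewrite ?pzscalerAl //.
by rewrite scalerDr lactZl ractZl.
Qed.

Fact tri_scaleAr (k : R) (x y : tri_sort) : k *: (x * y) = x * (k *: y).
Proof.
case: x y => [[a m] b] [[a' m'] b'].
congr (_, _, _); rewrite ?pzscalerAr //.
by rewrite scalerDr lactZr ractZr.
Qed.

Definition tri : pzAlgebra R :=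
  @PzAlgebra R tri_sort *:%R (@scalerA R tri_sort) (@scale1r R tri_sort)
    (@scalerDr R tri_sort) (@scalerDl R tri_sort)
    tri_scaleAl tri_scaleAr.

End TriangularAlgebra.

Arguments tri {R} A B M.

Definition alg_isomorphic (R : comPzRingType) (X Y : pzAlgebra R) : Prop :=
  exists f : X -> Y, [/\ linear f, GRing.monoid_morphism f & bijective f].

(* A unital ring is nonzero exactly when 1 != 0. *)
Definition has_triangular_repr (R : comPzRingType) (X : pzAlgebra R) : Prop :=
  exists (A B : pzAlgebra R) (M : bimodType A B),
    [/\ (1 : A) != 0, (1 : B) != 0 & alg_isomorphic X (tri A B M)].

Definition nontrivial_idempotent (A : pzRingType) (e : A) : Prop :=
  [/\ e * e = e, e <> 0 & e <> 1].

(* Main.v *)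
Require Import Defs.
From HB Require Import structures.
From mathcomp Require Import all_boot all_order all_algebra.

(** A triangular matrix representation of an algebra [X] is the same thing as
    a nontrivial idempotent [e] of [X] with [(1 - e) X e = 0]: in [Tri(A; M; B)]
    take the matrix unit [e = diag(1, 0)], for which [(1 - e) x e] is the lower
    left corner of [x]; in the other direction, the Peirce decomposition
    [X = eXe + eX(1 - e) + (1 - e)Xe + (1 - e)X(1 - e)] loses its third term,
    and [X] becomes [Tri(eXe; eX(1 - e); (1 - e)X(1 - e))]. This is
    [triangular_reprP].

    It remains to compare idempotents of the trivial extension and of [A]. From
    [e] one gets [(e, 0)]. Conversely, if [(e, m)] is an idempotent then
    [e * e = e] and [e m + m e = m], so that [e = 0] or [e = 1] forces [m = 0]:
    the first component of a nontrivial idempotent is nontrivial. As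
    [(0, n)] is multiplied by [(e, m)] through [e] alone, the condition
    [(1 - E) x E = 0] for [E = (e, m)] gives both [(1 - e) A e = 0] and
    [(1 - e) M e = 0]. The last claim is [triangular_reprP] applied to [A]. *)

Set Implicit Arguments.
Unset Strict Implicit.
Unset Printing Implicit Defensive.

Import GRing.Theory.
Local Open Scope ring_scope.

Section BimoduleZero.
Variables (R : comPzRingType) (A B : pzAlgebra R) (M : bimodType A B).

Lemma lact0l (m : M) : lact (0 : A) m = 0.
Proof. by apply: (addrI (lact 0 m)); rewrite -lactDl !addr0. Qed.

Lemma ract0r (m : M) : ract m (0 : B) = 0.
Proof. by apply: (addrI (ract m 0)); rewrite -ractDr !addr0. Qed.

End BimoduleZero.

(** * Peirce components *)

Section Peirce.
Variables (R : comPzRingType) (X : pzAlgebra R).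

(** For idempotents [g] and [h] this is [gXh]. Elements are recognized by the
    two equations rather than as values [g * y * h], which makes membership
    decidable and closure under products immediate. *)
Definition peirce_pred (g h : X) : {pred X} :=
  [pred x | (g * x == x) && (x * h == x)].

Lemma peirce_submod_closed g h : submod_closed (peirce_pred g h).
Proof.
split=> [|k x y]; rewrite !inE ?mulr0 ?mul0r ?eqxx //.
move=> /andP[/eqP gx /eqP xh] /andP[/eqP gy /eqP yh].
by rewrite mulrDr mulrDl -pzscalerAr -pzscalerAl gx gy xh yh !eqxx.
Qed.

HB.instance Definition _ g h :=
  GRing.isSubmodClosed.Build R X (peirce_pred g h) (peirce_submod_closed g h).

Record peirce (g h : X) := Peirce {
  peirce_val : X;
  peirce_valP : peirce_val \in peirce_pred g h
}.

HB.instance Definition _ g h := [isSub for @peirce_val g h].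
HB.instance Definition _ g h := [Choice of peirce g h by <:].
HB.instance Definition _ g h :=
  [SubChoice_isSubLmodule of peirce g h by <:].

Lemma peirce_mull g h (x : peirce g h) : g * val x = val x.
Proof. by have /andP[/eqP] := valP x. Qed.

Lemma peirce_mulr g h (x : peirce g h) : val x * h = val x.
Proof. by have /andP[_ /eqP] := valP x. Qed.

Fact peirce_mul_subproof g h k (x : peirce g h) (y : peirce h k) :
  val x * val y \in peirce_pred g k.
Proof. by rewrite inE mulrA peirce_mull -mulrA peirce_mulr !eqxx. Qed.

(** This single product gives both the multiplication of the corner algebras
    and their actions on the off-diagonal component. *)
Definition peirce_mul g h k (x : peirce g h) (y : peirce h k) : peirce g k :=
  Peirce (peirce_mul_subproof x y).

Fact peirce_proj_subproof g h (gI : g * g = g) (hI : h * h = h) (x : X) :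
  g * x * h \in peirce_pred g h.
Proof. by rewrite inE -mulrA mulrA gI -!mulrA hI !eqxx. Qed.

Definition peirce_proj g h (gI : g * g = g) (hI : h * h = h) (x : X) :
  peirce g h := Peirce (peirce_proj_subproof gI hI x).

(** * The corner algebra of an idempotent *)

Section Corner.
Variables (g : X) (gI : g * g = g).

(** The unit [g] of the corner depends on the proof that [g] is idempotent;
    the alias carries that proof. *)
Definition corner_sort of g * g = g : Type := peirce g g.
Local Notation C := (corner_sort gI).

HB.instance Definition _ := GRing.Lmodule.on C.

Fact corner_one_subproof : g \in peirce_pred g g.
Proof. by rewrite inE gI eqxx. Qed.

Definition corner_one : C := Peirce corner_one_subproof.
Definition corner_mul (x y : C) : C := peirce_mul x y.

Fact corner_mulA : associative corner_mul.
Proof. by move=> x y z; apply: val_inj; apply: mulrA. Qed.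

Fact corner_mul1r : left_id corner_one corner_mul.
Proof. by move=> x; apply: val_inj; apply: peirce_mull. Qed.

Fact corner_mulr1 : right_id corner_one corner_mul.
Proof. by move=> x; apply: val_inj; apply: peirce_mulr. Qed.

Fact corner_mulDl : left_distributive corner_mul +%R.
Proof. by move=> x y z; apply: val_inj; apply: mulrDl. Qed.

Fact corner_mulDr : right_distributive corner_mul +%R.
Proof. by move=> x y z; apply: val_inj; apply: mulrDr. Qed.

HB.instance Definition _ := GRing.Zmodule_isPzRing.Build C
  corner_mulA corner_mul1r corner_mulr1 corner_mulDl corner_mulDr.

Fact corner_scaleAl (k : R) (x y : C) : k *: (x * y) = (k *: x) * y.
Proof. by apply: val_inj; apply: pzscalerAl. Qed.

Fact corner_scaleAr (k : R) (x y : C) : k *: (x * y) = x * (k *: y).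
Proof. by apply: val_inj; apply: pzscalerAr. Qed.

Definition corner : pzAlgebra R :=
  @PzAlgebra R C *:%R (@scalerA R C) (@scale1r R C)
    (@scalerDr R C) (@scalerDl R C) corner_scaleAl corner_scaleAr.

Lemma corner_neq0 : g <> 0 -> (1 : corner) != 0.
Proof. by move=> g0; apply/eqP => /(congr1 (@peirce_val g g)). Qed.

End Corner.

(** * The off-diagonal component as a bimodule over the corners *)

Section OffDiagonal.
Variables (g h : X) (gI : g * g = g) (hI : h * h = h).

Definition offdiag_sort of g * g = g & h * h = h : Type := peirce g h.
Local Notation P := (offdiag_sort gI hI).

HB.instance Definition _ := GRing.Lmodule.on P.

Definition offdiag_lact (a : corner gI) (m : P) : P :=
  peirce_mul (a : peirce g g) m.
Definition offdiag_ract (m : P) (b : corner hI) : P :=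
  peirce_mul m (b : peirce h h).

Fact offdiag_lactA a a' m :
  offdiag_lact (a * a') m = offdiag_lact a (offdiag_lact a' m).
Proof. by apply: val_inj; rewrite /= mulrA. Qed.

Fact offdiag_lact1 m : offdiag_lact 1 m = m.
Proof. by apply: val_inj; apply: peirce_mull. Qed.

Fact offdiag_lactDl a a' m :
  offdiag_lact (a + a') m = offdiag_lact a m + offdiag_lact a' m.
Proof. by apply: val_inj; apply: mulrDl. Qed.

Fact offdiag_lactDr a m m' :
  offdiag_lact a (m + m') = offdiag_lact a m + offdiag_lact a m'.
Proof. by apply: val_inj; apply: mulrDr. Qed.

Fact offdiag_lactZl k a m : offdiag_lact (k *: a) m = k *: offdiag_lact a m.
Proof. by apply: val_inj; apply/esym/pzscalerAl. Qed.

Fact offdiag_ractA m b b' :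
  offdiag_ract m (b * b') = offdiag_ract (offdiag_ract m b) b'.
Proof. by apply: val_inj; apply: mulrA. Qed.

Fact offdiag_ract1 m : offdiag_ract m 1 = m.
Proof. by apply: val_inj; apply: peirce_mulr. Qed.

Fact offdiag_ractDl m m' b :
  offdiag_ract (m + m') b = offdiag_ract m b + offdiag_ract m' b.
Proof. by apply: val_inj; apply: mulrDl. Qed.

Fact offdiag_ractDr m b b' :
  offdiag_ract m (b + b') = offdiag_ract m b + offdiag_ract m b'.
Proof. by apply: val_inj; apply: mulrDr. Qed.

Fact offdiag_ractZr k m b : offdiag_ract m (k *: b) = k *: offdiag_ract m b.
Proof. by apply: val_inj; apply/esym/pzscalerAr. Qed.

Fact offdiag_lract a m b :
  offdiag_ract (offdiag_lact a m) b = offdiag_lact a (offdiag_ract m b).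
Proof. by apply: val_inj; apply/esym/mulrA. Qed.

HB.instance Definition _ :=
  Lmodule_isBimodule.Build R (corner gI) (corner hI) P
    offdiag_lactA offdiag_lact1 offdiag_lactDl offdiag_lactDr offdiag_lactZl
    offdiag_ractA offdiag_ract1 offdiag_ractDl offdiag_ractDr offdiag_ractZr
    offdiag_lract.

Definition offdiag : bimodType (corner gI) (corner hI) := P.

End OffDiagonal.

(** * Triangular representations and idempotents *)

Section PeirceIsomorphism.
Variables (e : X) (eI : e * e = e).
Hypothesis e_tri : forall x : X, (1 - e) * x * e = 0.
Let f := 1 - e.

Let ef0 : e * f = 0. Proof. by rewrite mulrBr mulr1 eI subrr. Qed.
Let fe0 : f * e = 0. Proof. by rewrite mulrBl mul1r eI subrr. Qed.
Let fI : f * f = f. Proof. by rewrite [LHS]mulrBr fe0 mulr1 subr0. Qed.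

(** The Peirce decomposition of the identity inserted between two factors. *)
Let mul_split (x y : X) : x * y = x * e * (e * y) + x * f * (f * y).
Proof.
by rewrite -!mulrA (mulrA e) (mulrA f) eI fI -mulrDr -mulrDl addrC subrK mul1r.
Qed.

Definition peirce_tri (x : X) : tri (corner eI) (corner fI) (offdiag eI fI) :=
  ((peirce_proj eI eI x, peirce_proj eI fI x), peirce_proj fI fI x).

Definition peirce_sum (t : tri (corner eI) (corner fI) (offdiag eI fI)) : X :=
  peirce_val t.1.1 + peirce_val t.1.2 + peirce_val t.2.

Lemma peirce_proj_linear g h (gI : g * g = g) (hI : h * h = h) :
  linear (peirce_proj gI hI).
Proof.
move=> k x y; apply: val_inj => /=.
by rewrite mulrDr mulrDl -pzscalerAr -pzscalerAl.
Qed.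

Lemma peirce_tri_linear : linear peirce_tri.
Proof. by move=> k x y; rewrite /peirce_tri !peirce_proj_linear. Qed.

Lemma peirce_tri_monoid_morphism : GRing.monoid_morphism peirce_tri.
Proof.
split=> [|x y].
  by congr (_, _, _); apply: val_inj; rewrite /= mulr1 ?eI ?ef0 ?fI.
have split_proj (g h : X) :
    g * (x * y) * h = g * x * e * (e * y * h) + g * x * f * (f * y * h).
  by rewrite mulrA -mulrA mul_split !mulrA.
(* The terms through [f _ e] vanish, leaving the triangular product. *)
congr (_, _, _); apply: val_inj; rewrite /= split_proj.
- by rewrite e_tri mulr0 addr0.
- by [].
- by rewrite e_tri mul0r add0r.
Qed.

Lemma peirce_triK : cancel peirce_tri peirce_sum.
Proof.
move=> x; rewrite /peirce_sum /= -mulrDr addrC.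
(* The missing component [f * x * e] is zero, and is added back. *)
rewrite -[f * x * f]add0r -(e_tri x) -/f -mulrDr.
by rewrite [e + f]addrC subrK !mulr1 -mulrDl subrK mul1r.
Qed.

Lemma peirce_sumK : cancel peirce_sum peirce_tri.
Proof.
move=> [[a m] b]; rewrite /peirce_sum /=.
have ea := peirce_mull a; have ae := peirce_mulr a.
have em := peirce_mull m; have mf := peirce_mulr m.
have fb := peirce_mull b; have bf := peirce_mulr b.
have fa : f * val a = 0 by rewrite -ea mulrA fe0 mul0r.
have af : val a * f = 0 by rewrite -ae -mulrA ef0 mulr0.
have fm : f * val m = 0 by rewrite -em mulrA fe0 mul0r.
have me : val m * e = 0 by rewrite -mf -mulrA fe0 mulr0.
have eb : e * val b = 0 by rewrite -fb mulrA ef0 mul0r.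
congr (_, _, _); apply: val_inj; rewrite /= !(mulrDr e, mulrDr f).
- by rewrite ea em eb addr0 mulrDl ae me addr0.
- by rewrite ea em eb addr0 (mulrDl _ _ f) af mf add0r.
- by rewrite fa fm fb !add0r.
Qed.

Lemma peirce_tri_isomorphic :
  alg_isomorphic X (tri (corner eI) (corner fI) (offdiag eI fI)).
Proof.
exists peirce_tri; split; first exact: peirce_tri_linear.
- exact: peirce_tri_monoid_morphism.
- by exists peirce_sum; [exact: peirce_triK | exact: peirce_sumK].
Qed.

Lemma idempotent_triangular_repr :
  e <> 0 -> e <> 1 -> has_triangular_repr X.
Proof.
move=> e0 e1; exists (corner eI), (corner fI), (offdiag eI fI).
split; [exact: corner_neq0 | apply: corner_neq0 | exact: peirce_tri_isomorphic].
by move=> /subr0_eq /esym.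
Qed.

End PeirceIsomorphism.

(** From left to right, the idempotent is the preimage of the matrix unit
    [diag(1, 0)]; it is nontrivial because both diagonal algebras are
    nonzero. *)
Lemma triangular_reprP :
  has_triangular_repr X <->
  exists e : X, nontrivial_idempotent e /\ forall x : X, (1 - e) * x * e = 0.
Proof.
split=> [[A [B [M [A1 B1]]]] | [e [[eI e0 e1] e_tri]]]; last first.
  exact: (idempotent_triangular_repr eI).
case=> phi [phi_lin [phi1 phiM] [psi phiK psiK]].
have phi_inj := can_inj phiK.
have phiB x y : phi (x - y) = phi x - phi y.
  by rewrite addrC -scaleN1r phi_lin scaleN1r addrC.
have phi0 : phi 0 = 0 by rewrite -(subrr 0) phiB subrr.
pose E : tri A B M := ((1, 0), 0).
have phiE : phi (psi E) = E by [].
exists (psi E); split.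
  split.
  - apply: phi_inj; rewrite phiM phiE.
    by congr (_, _, _); rewrite ?mulr1 ?mulr0 // lactr0 ractl0 addr0.
  - by move=> /(congr1 phi); rewrite phiE phi0 => -[/eqP]; apply/negP.
  - move=> /(congr1 phi); rewrite phiE phi1 => -[/esym/eqP].
    exact/negP.
move=> x; apply: phi_inj; rewrite !phiM phiB phi1 phiE phi0.
case: (phi x) => [[a m] b]; congr (_, _, _) => /=.
- by rewrite subrr !mul0r.
- by rewrite lactr0 ract0r addr0.
- by rewrite mulr0.
Qed.
End Peirce.

(** * Idempotents of the trivial extension *)

Section TrivialExtensionIdempotents.
Variables (R : comPzRingType) (A : pzAlgebra R) (M : bimodType A A).

(** A triangularizing idempotent [(e, m)] may have [m <> 0], but its first
    component is triangularizing and so [m] can be discarded. *)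
Lemma trivext_triangular_reprP :
  has_triangular_repr (trivext A M) <->
  exists e : A,
    [/\ nontrivial_idempotent e,
        forall a : A, (1 - e) * a * e = 0 &
        forall m : M, ract (lact (1 - e) m) e = 0].
Proof.
split=> [/triangular_reprP[[e m] [[E_idem E0 E1] E_tri]] |
         [e [[eI e0 e1] eA eM]]].
  have /= [eI em] := (congr1 fst E_idem, congr1 snd E_idem).
  exists e; split.
  - split=> // e_triv.
    + by apply: E0; congr pair; rewrite // -em /= e_triv lact0l ract0r addr0.
    (* With [e = 1], [e m + m e = m] reads [m + m = m]. *)
    + apply: E1; congr pair; rewrite //.
      by apply: (addrI m); rewrite addr0 -[RHS]em /= e_triv lact1 ract1.
  - by move=> a; have := congr1 fst (E_tri (a, 0)).
  - move=> n.
    (* Testing on [(0, n)] isolates the action of [e]: the contributions of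
       [m] are multiplied by [0]. *)
    have /(congr1 snd) := E_tri (0, n).
    rewrite -[LHS]/(lact ((1 - e) * 0) m +
                    ract (lact (1 - e) n + ract (0 - m) 0) e).
    by rewrite mulr0 lact0l add0r ract0r addr0.
apply/triangular_reprP; exists ((e, 0) : trivext A M); split; first split.
- by congr pair; rewrite //= lactr0 ractl0 addr0.
- by case.
- by case.
move=> [a m]; apply: (congr2 pair); first exact: eA.
rewrite -[LHS]/(lact ((1 - e) * a) 0 +
                ract (lact (1 - e) m + ract (0 - 0) a) e).
by rewrite lactr0 add0r subrr ractl0 addr0 eM.
Qed.

End TrivialExtensionIdempotents.

Theorem proposition2p1 (R : comPzRingType) (A : pzAlgebra R)
    (M : bimodType A A) :
  (has_triangular_repr (trivext A M) <->
   exists e : A,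
     [/\ nontrivial_idempotent e,
         forall a : A, (1 - e) * a * e = 0 &
         forall m : M, ract (lact (1 - e) m) e = 0]) /\
  (has_triangular_repr (trivext A M) -> has_triangular_repr A).
Proof.
split; first exact: trivext_triangular_reprP.
move=> /trivext_triangular_reprP[e [e_idem eA _]].
by apply/triangular_reprP; exists e.
Qed.
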